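(* Define, for every integer $k\ge 0$, the formal power series $$A^{(k)}_{231}(x,t)=1+\sum_{n\ge 1}\Big(\sum_{\sigma\in S_n(231),\ \mathrm{maxdrop}(\sigma)\le k} x^{\mathrm{des}(\sigma)}\Big)t^n .$$ Then $A^{(0)}_{231}(x,t)=\frac{1}{1-t}$, and for all $k\ge 1$, $$A^{(k)}_{231}(x,t)=\frac{1}{1-t+tx-txA^{(k-1)}_{231}(x,t)}.$$
   Context: For a permutation $\sigma=\sigma_1\cdots\sigma_n$ of $[n]=\{1,\dots,n\}$, $\mathrm{des}(\sigma)$ is the number of $i\in[n-1]$ with $\sigma_i>\sigma_{i+1}$, and $\mathrm{maxdrop}(\sigma)=\max\{i-\sigma_i : i\in[n]\}$. $S_n(231)$ denotes the set of permutations of $[n]$ avoiding the pattern $231$, i.e. there are no indices $a<b<c$ with $\sigma_c<\sigma_a<\sigma_b$. *)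

(* Defs.v *)
From HB Require Import structures.
From mathcomp Require Import all_boot all_order all_fingroup all_algebra.
From mathcomp Require Import boolp.

Set Implicit Arguments.
Unset Strict Implicit.
Unset Printing Implicit Defensive.

Import Order.TTheory GRing.Theory Num.Theory.
Local Open Scope ring_scope.

(* {fps R} is the ring R[[t]].  It is a record rather than an alias of
   nat -> R because the latter may carry the pointwise ring structure.  Decidable
   equality, choice and extensionality of nat -> R are the classical ones. *)
Record fps (R : Type) : Type := Fps { fcoef : nat -> R }.

Notation "{ 'fps' R }" := (fps R) (at level 0, format "{ 'fps'  R }").

HB.instance Definition _ (R : Type) := gen_eqMixin {fps R}.
HB.instance Definition _ (R : Type) := gen_choiceMixin {fps R}.

Lemma fpsP (R : Type) (f g : {fps R}) : fcoef f =1 fcoef g -> f = g.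
Proof. by case: f g => [f] [g] /= /funext ->. Qed.

Section FpsZmodule.
Variable R : zmodType.
Implicit Types f g h : {fps R}.

Definition fps_zero : {fps R} := Fps (fun=> 0).
Definition fps_opp f : {fps R} := Fps (fun n => - fcoef f n).
Definition fps_add f g : {fps R} := Fps (fun n => fcoef f n + fcoef g n).

Fact fps_addA : associative fps_add.
Proof. by move=> f g h; apply/fpsP => n /=; rewrite addrA. Qed.
Fact fps_addC : commutative fps_add.
Proof. by move=> f g; apply/fpsP => n /=; rewrite addrC. Qed.
Fact fps_add0 : left_id fps_zero fps_add.
Proof. by move=> f; apply/fpsP => n /=; rewrite add0r. Qed.
Fact fps_addN : left_inverse fps_zero fps_opp fps_add.
Proof. by move=> f; apply/fpsP => n /=; rewrite addNr. Qed.

HB.instance Definition _ :=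
  GRing.isZmodule.Build {fps R} fps_addA fps_addC fps_add0 fps_addN.

End FpsZmodule.

Section FpsRing.
Variable R : comNzRingType.
Implicit Types f g h : {fps R}.

Definition fpsC (c : R) : {fps R} := Fps (fun n => if n == 0%N then c else 0).

(* The variable t. *)
Definition fpsT : {fps R} := Fps (fun n => (n == 1%N)%:R).

Definition fps_mul f g : {fps R} :=
  Fps (fun n => \sum_(i < n.+1) fcoef f i * fcoef g (n - i)%N).

Let trunc N f : {poly R} := \poly_(i < N) fcoef f i.

Let coef_mul N f g n : (n < N)%N ->
  fcoef (fps_mul f g) n = (trunc N f * trunc N g)`_n.
Proof.
move=> nN; rewrite coefM; apply: eq_bigr => i _; rewrite !coef_poly.
have iN : (i < N)%N by apply: leq_trans nN; apply: ltn_ord.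
by rewrite iN (leq_ltn_trans (leq_subr _ _) nN).
Qed.

Fact fps_mulC : commutative fps_mul.
Proof. by move=> f g; apply/fpsP => n; rewrite !(@coef_mul n.+1) // mulrC. Qed.

Fact fps_mulA : associative fps_mul.
Proof.
have AE f g h n : fcoef (fps_mul f (fps_mul g h)) n
    = (trunc n.+1 f * (trunc n.+1 g * trunc n.+1 h))`_n.
  rewrite coefM; apply: eq_bigr => i _.
  by rewrite coef_poly ltn_ord (@coef_mul n.+1) // ltnS leq_subr.
move=> f g h; rewrite (fps_mulC (fps_mul f g)).
by apply/fpsP => n; rewrite !AE mulrA mulrC.
Qed.

Fact fps_mul1 : left_id (fpsC 1) fps_mul.
Proof.
move=> f; apply/fpsP => n /=; rewrite big_ord_recl /= subn0 mul1r big1 ?addr0 //.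
by move=> i _; rewrite mul0r.
Qed.

Fact fps_mulDl : left_distributive fps_mul +%R.
Proof.
move=> f g h; apply/fpsP => n /=.
by rewrite -big_split /=; apply: eq_bigr => i _; rewrite mulrDl.
Qed.

Fact fps_1neq0 : fpsC 1 != 0.
Proof. by apply/eqP => /(congr1 (fun f => fcoef f 0)) /eqP /=; rewrite oner_eq0. Qed.

HB.instance Definition _ := GRing.Zmodule_isComNzRing.Build {fps R}
  fps_mulA fps_mulC fps_mul1 fps_mulDl fps_1neq0.

End FpsRing.

Section FpsUnitRing.
Variable R : comUnitRingType.
Implicit Types f g h : {fps R}.

(* A power series is a unit iff its constant term is; the coefficients of
   g = f^-1 are then given by f_0 g_n = [n = 0] - \sum_(i < n) f_(n-i) g_i.
   As usual for unit rings, the inverse of a non-unit is itself. *)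
Definition fps_unit : {pred {fps R}} := [pred f | fcoef f 0 \is a GRing.unit].

Definition fps_inv_step f (s : seq R) : seq R :=
  rcons s ((fcoef f 0)^-1 *
    ((size s == 0%N)%:R - \sum_(i < size s) fcoef f (size s - i)%N * s`_i)).

Definition fps_inv f : {fps R} :=
  if fps_unit f then Fps (fun n => (iter n.+1 (fps_inv_step f) [::])`_n) else f.

Fact fps_mulVx : {in fps_unit, left_inverse 1 fps_inv *%R}.
Proof.
move=> f f_unit; have uf0 : fcoef f 0 \is a GRing.unit by [].
have {}f_unit : fps_unit f by [].
rewrite mulrC /fps_inv f_unit; set g := fun n => _.
have szI n : size (iter n (fps_inv_step f) [::]) = n.
  by elim: n => //= n IH; rewrite size_rcons IH.
have gE n i : (i < n)%N -> (iter n (fps_inv_step f) [::])`_i = g i.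
  elim: n => // n IH; rewrite ltnS leq_eqVlt => /predU1P[-> //|lt_in].
  by rewrite iterS nth_rcons szI lt_in IH.
apply/fpsP => n; rewrite [LHS]/= big_ord_recl subn0.
have -> : g n = (fcoef f 0)^-1 *
    ((n == 0%N)%:R - \sum_(i < n) fcoef f (n - i)%N * g i).
  rewrite /g iterS nth_rcons szI ltnn eqxx; congr (_ * (_ - _)).
  by apply: eq_bigr => i _; rewrite gE.
rewrite mulVKr //= [X in _ + X](reindex_inj rev_ord_inj) /=.
rewrite [X in _ + X](eq_bigr (fun i : 'I_n => fcoef f (n - i)%N * g i)).
  by rewrite subrK; case: n.
by move=> i _; rewrite /bump add1n -subSn // subSS subKn // ltnW.
Qed.

Fact fps_unitPl f g : g * f = 1 -> fps_unit f.
Proof.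
move=> /(congr1 (fun f => fcoef f 0)) /=; rewrite big_ord1 => gf1.
by apply/unitrPr; exists (fcoef g 0); rewrite mulrC.
Qed.

Fact fps_inv_out : {in [predC fps_unit], fps_inv =1 id}.
Proof.
move=> f f_nunit; rewrite /fps_inv; case: ifP => // f_unit.
by move: f_nunit; rewrite !inE [_ \is a _]f_unit.
Qed.

HB.instance Definition _ := GRing.ComNzRing_hasMulInverse.Build {fps R}
  fps_mulVx fps_unitPl fps_inv_out.

Lemma unitfps1DTM f : 1 + fpsT R * f \is a GRing.unit.
Proof.
suff : fcoef (1 + fpsT R * f) 0 \is a GRing.unit by [].
by rewrite /= big_ord1 mul0r addr0 unitr1.
Qed.

End FpsUnitRing.

Definition des n (s : 'S_n) : nat :=
  #|[set i : 'I_n | [exists j : 'I_n, (j == i.+1 :> nat) && (s j < s i)%N]]|.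

(* Subtraction is truncated, but this is harmless: see maxdropP. *)
Definition maxdrop n (s : 'S_n) : nat := \max_(i < n) (i - s i)%N.

Lemma maxdropP n (s : 'S_n.+1) :
  (forall i : 'I_n.+1, i%:Z - (s i)%:Z <= (maxdrop s)%:Z) /\
  (exists i : 'I_n.+1, i%:Z - (s i)%:Z = (maxdrop s)%:Z).
Proof.
have le_drop (i : 'I_n.+1) : (i - s i <= maxdrop s)%N.
  exact: (leq_bigmax (F := fun i : 'I_n.+1 => (i - s i)%N)).
split=> [i|].
  by rewrite lerBlDr -PoszD lez_nat addnC -leq_subLR.
have [i maxE] : {i : 'I_n.+1 | maxdrop s = (i - s i)%N}.
  by rewrite /maxdrop; case: (@bigop.eq_bigmax _ (fun i : 'I_n.+1 => (i - s i)%N)) => [|i ->];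
    [rewrite card_ord | exists i].
case: (leqP (s i) i) => [le_si|lt_is]; first by exists i; rewrite maxE subzn.
have max0 : maxdrop s = 0%N by rewrite maxE; apply/eqP; rewrite subn_eq0 ltnW.
exists ord_max; rewrite max0; apply/eqP; rewrite subr_eq0 eqz_nat eqn_leq.
apply/andP; split; last exact: leq_ord.
by rewrite -subn_eq0 -leqn0 -[leqRHS]max0 le_drop.
Qed.

Definition avoids231 n (s : 'S_n) : bool :=
  ~~ [exists a : 'I_n, exists b : 'I_n, exists c : 'I_n,
        [&& (a < b)%N, (b < c)%N, (s c < s a)%N & (s a < s b)%N]].

Definition A231_coef (k n : nat) : {poly int} :=
  \sum_(s : 'S_n | avoids231 s && (maxdrop s <= k)%N) 'X^(des s).

Definition A231 (k : nat) : {fps {poly int}} :=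
  Fps (fun n => if n == 0%N then 1 else A231_coef k n).

(* Main.v *)
(** Write sigma in S_(p+q+1)(231) as L m R, with m the largest value and |L| = p,
    |R| = q.  Avoidance of 231 forces every value of L to be below every value of
    R, so L is a 231-avoiding permutation of the p smallest values and R is one
    of the next q values.  The values of R are shifted by p but its positions by
    p + 1, so each drop in R increases by one: R must have maxdrop at most k - 1,
    and must be empty if k = 0.  A nonempty R also creates the descent from m.
    Hence A_k = 1 + t A_k C_k with C_k = 1 - x + x A_(k-1) for k >= 1, C_0 = 1. *)
Require Import Defs.
From HB Require Import structures.
From mathcomp Require Import all_boot all_order all_fingroup all_algebra.
From mathcomp Require Import zify ring.

Set Implicit Arguments.
Unset Strict Implicit.
Unset Printing Implicit Defensive.

Import GRing.Theory.

Local Open Scope ring_scope.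

(** * Permutations as functions on natural numbers, where shifting positions needs no casts between
    ordinal types *)

Section PermutationsAsNatFunctions.
Local Open Scope nat_scope.

(* Values outside [0, n) are junk: 0. *)
Definition pval n (s : 'S_n) (i : nat) : nat :=
  oapp (fun j : 'I_n => s j : nat) 0 (insub i).

Lemma pvalE n (s : 'S_n) (i : 'I_n) : pval s i = s i.
Proof. by rewrite /pval valK. Qed.

Lemma pval_ltn n (s : 'S_n) i : i < n -> pval s i < n.
Proof. by move=> lt_in; rewrite (pvalE s (Ordinal lt_in)). Qed.

Lemma pval_inj n (s : 'S_n) i j :
  i < n -> j < n -> pval s i = pval s j -> i = j.
Proof.
move=> lt_in lt_jn; rewrite (pvalE s (Ordinal lt_in)) (pvalE s (Ordinal lt_jn)).
by move=> /val_inj/perm_inj/(congr1 val).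
Qed.

Lemma eq_pval n (s s' : 'S_n) :
  (forall i, i < n -> pval s i = pval s' i) -> s = s'.
Proof.
by move=> ss'; apply/permP => i; apply: val_inj; rewrite /= -!pvalE ss'.
Qed.

(* The identity if f does not permute [0, n). *)
Definition nat_perm n (f : nat -> nat) : 'S_n :=
  odflt 1%g [pick s : 'S_n | [forall i : 'I_n, s i == f i :> nat]].

Lemma nat_permE n (f : nat -> nat) :
    (forall i, i < n -> f i < n) ->
    (forall i j, i < n -> j < n -> f i = f j -> i = j) ->
  forall i, i < n -> pval (nat_perm n f) i = f i.
Proof.
move=> f_lt f_inj i lt_in; rewrite (pvalE _ (Ordinal lt_in)) /nat_perm.
case: pickP => [s /forallP/(_ (Ordinal lt_in))/eqP // | no_s].
pose g (j : 'I_n) := Ordinal (f_lt j (ltn_ord j)).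
have g_inj : injective g.
  by move=> a b /(congr1 val)/= /f_inj eq_ab; apply/val_inj/eq_ab.
by have /forallP[] := no_s (perm g_inj); move=> j; rewrite permE.
Qed.

Lemma inj_bound m r (f : nat -> nat) :
    (forall i, i < m -> f i < r) ->
    (forall i j, i < m -> j < m -> f i = f j -> i = j) -> m <= r.
Proof.
move=> f_lt f_inj; pose g (j : 'I_m) := Ordinal (f_lt j (ltn_ord j)).
have /leq_card : injective g.
  by move=> a b /(congr1 val)/= /f_inj eq_ab; apply/val_inj/eq_ab.
by rewrite !card_ord.
Qed.

Lemma avoidsP n (s : 'S_n) :
  reflect (forall a b c, a < b -> b < c -> c < n ->
             pval s c < pval s a -> pval s a < pval s b -> False)
          (avoids231 s).
Proof.
apply: (iffP idP) => [av a b c ab bc cn ca sab | av].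
  have bn := ltn_trans bc cn; have an := ltn_trans ab bn.
  move/negP: av; apply; apply/existsP; exists (Ordinal an).
  apply/existsP; exists (Ordinal bn); apply/existsP; exists (Ordinal cn).
  by rewrite -!pvalE ab bc ca.
apply/negP => /existsP[a /existsP[b /existsP[c /and4P[ab bc ca sab]]]].
by apply: (av a b c); rewrite ?pvalE.
Qed.

(** The guard [i.+1 < n] discards the last position, where the junk value [pval s n = 0] could pass
    for a descent. *)
Lemma desE n (s : 'S_n) :
  des s = \sum_(0 <= i < n) ((i.+1 < n) && (pval s i.+1 < pval s i)).
Proof.
rewrite big_mkord /des cardsE -sum1_card big_mkcond /=; apply: eq_bigr => i _.
rewrite unfold_in pvalE; case: ltnP => [lt_in | le_ni] /=.
  have -> // : [exists j : 'I_n, (j == i.+1 :> nat) && (s j < s i)]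
             = (pval s i.+1 < s i).
  apply/existsP/idP => [[j /andP[/eqP <-]] | lt_s]; first by rewrite pvalE.
  by exists (Ordinal lt_in); rewrite -pvalE eqxx.
case: existsP => // -[j /andP[/eqP eq_j _]].
by have := ltn_ord j; rewrite eq_j ltnNge le_ni.
Qed.

Lemma maxdrop_leP n (s : 'S_n) k :
  reflect (forall i, i < n -> i - pval s i <= k) (maxdrop s <= k).
Proof.
apply: (iffP (bigmax_leqP _ _ _)) => dr i => [lt_in | _].
  by rewrite (pvalE s (Ordinal lt_in)) dr.
by rewrite -pvalE dr.
Qed.

(** * The decomposition L m R around the maximum, with positions and values counted from 0 *)

Definition glue p q (w : 'S_p) (v : 'S_q) : 'S_(p + q).+1 :=
  nat_perm _ (fun i => if i < p then pval w i
                       else if i == p then p + q else p + pval v (i - p.+1)).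

Section Glue.
Variables (p q : nat) (w : 'S_p) (v : 'S_q).

Lemma glueE i : i < (p + q).+1 ->
  pval (glue w v) i = if i < p then pval w i
                      else if i == p then p + q else p + pval v (i - p.+1).
Proof.
apply: nat_permE => {}i => [lt_i | j lt_i lt_j].
  case: (ltnP i p) => [ip|le_pi]; first by have := pval_ltn w ip; lia.
  case: eqP => ne_ip; first by lia.
  have iq : i - p.+1 < q by lia.
  by have := pval_ltn v iq; lia.
have wlt a : a < p -> pval w a < p by apply: pval_ltn.
have vlt a : p < a -> a < (p + q).+1 -> pval v (a - p.+1) < q.
  by move=> ? ?; apply: pval_ltn; lia.
have := wlt i; have := wlt j; have := vlt i; have := vlt j.
case: (ltngtP i p) => ip; case: (ltngtP j p) => jp; try lia.
- by move=> _ _ _ _; apply: pval_inj.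
- move=> _ _ _ _ /addnI eq_v; suff : i - p.+1 = j - p.+1 by lia.
  by apply: (pval_inj (s := v)) => //; lia.
Qed.

Lemma glueL i : i < p -> pval (glue w v) i = pval w i.
Proof. by move=> ip; rewrite glueE ?ip //; lia. Qed.

Lemma glueM : pval (glue w v) p = p + q.
Proof. by rewrite glueE ?ltnn ?eqxx //; lia. Qed.

Lemma glueR j : j < q -> pval (glue w v) (p.+1 + j) = p + pval v j.
Proof.
move=> jq; rewrite glueE; last by lia.
by rewrite addKn !ifF //; lia.
Qed.

(** In a 231 pattern at a < b < c, if a lies in L then so does c, since the values from position p
    on exceed those of L. Nothing exceeds the maximum, so a is not p. Hence the pattern lies
    entirely in L or entirely in R. *)
Lemma glue_avoids : avoids231 (glue w v) = avoids231 w && avoids231 v.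
Proof.
apply/avoidsP/andP => [av | [/avoidsP avw /avoidsP avv] a b c ab bc cn].
  split; apply/avoidsP => a b c ab bc cn.
    by move=> *; apply: (av a b c); rewrite ?glueL //; lia.
  by move=> *; apply: (av (p.+1 + a) (p.+1 + b) (p.+1 + c)); rewrite ?glueR //; lia.
have wlt i : i < p -> pval w i < p by apply: pval_ltn.
have [cp | pc] := ltnP c p.
  by rewrite !glueL; [apply: avw | lia..].
have [ap | pa] := ltnP a p.
  rewrite (glueL ap); have := wlt a ap; case: (ltngtP c p) pc => // [pc | ->] _.
    by rewrite (_ : c = p.+1 + (c - p.+1)) ?glueR; lia.
  by rewrite glueM; lia.
case: (ltngtP a p) pa => // [pa | ->] _; last first.
  rewrite glueM => _; have bn : b < (p + q).+1 by lia.
  by have := pval_ltn (glue w v) bn; lia.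
rewrite (_ : a = p.+1 + (a - p.+1)); last by lia.
rewrite (_ : b = p.+1 + (b - p.+1)); last by lia.
rewrite (_ : c = p.+1 + (c - p.+1)); last by lia.
rewrite !glueR; try lia.
by rewrite !ltn_add2l; apply: avv; lia.
Qed.

Lemma glue_maxdrop k :
  (maxdrop (glue w v) <= k) =
  (maxdrop w <= k) && [forall j : 'I_q, j.+1 - v j <= k].
Proof.
apply/maxdrop_leP/andP => [dr | [/maxdrop_leP drw /forallP drv] i lt_i].
  split; first by apply/maxdrop_leP => i ip; rewrite -glueL ?dr //; lia.
  apply/forallP => j; have := dr (p.+1 + j); rewrite glueR // pvalE.
  by have := ltn_ord j; lia.
have [ip | pi] := ltnP i p; first by rewrite glueL ?drw.
case: (ltngtP i p) pi => // [pi | ->] _; last by rewrite glueM; lia.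
have jq : i - p.+1 < q by lia.
have := drv (Ordinal jq); rewrite -pvalE /= -[X in pval (glue w v) X](subnKC pi) glueR //; lia.
Qed.

Lemma glue_des : des (glue w v) = des w + (0 < q) + des v.
Proof.
(* Cut the sum at position p: descents of L, then the one out of the maximum, then those of R. *)
rewrite !desE (@big_cat_nat _ _ _ p) ?leqW ?leq_addr //= -addnA; congr (_ + _).
  rewrite [LHS]big_nat [RHS]big_nat; apply: eq_bigr => i /= ip.
  rewrite (glueL ip); have [lt_ip | le_pi] := ltnP i.+1 p.
    by rewrite glueL //; congr (nat_of_bool (_ && _)); lia.
  (* The last letter of L is followed by the maximum, so it starts no descent. *)
  have -> : i.+1 = p by lia.
  by rewrite glueM; have := pval_ltn w ip; lia.
rewrite big_ltn; last by lia.
congr (_ + _).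
  rewrite glueM ltnS; have [q0 | q_gt0] := posnP q; first by lia.
  by rewrite -[X in pval _ X]addn0 glueR //; have := pval_ltn v q_gt0; lia.
rewrite -{1}[p.+1]add0n big_addn (_ : _ - _ = q); last by lia.
rewrite [LHS]big_nat [RHS]big_nat; apply: eq_bigr => j /= jq.
rewrite [j + _]addnC glueR // -addnS.
have [lt_jq | le_qj] := ltnP j.+1 q; last by rewrite (_ : _ < _ = false); lia.
by rewrite glueR // ltn_add2l; congr (nat_of_bool (_ && _)); lia.
Qed.

End Glue.

Lemma glue_inj p q (w w' : 'S_p) (v v' : 'S_q) :
  glue w v = glue w' v' -> w = w' /\ v = v'.
Proof.
move=> eq_g; split; apply: eq_pval => i lt_i.
  by rewrite -(glueL w v) // eq_g glueL.
by apply: (@addnI p); rewrite -(glueR w v) // eq_g glueR.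
Qed.

(** Avoidance puts the values of L below those of R; counting distinct values then shows that L
    takes exactly the values below p. *)
Lemma glue_surj p q (s : 'S_(p + q).+1) : avoids231 s -> pval s p = p + q ->
  exists w : 'S_p, exists v : 'S_q, s = glue w v.
Proof.
move=> /avoidsP av smax.
have s_inj := @pval_inj _ s.
have s_lt i : i < (p + q).+1 -> i != p -> pval s i < p + q.
  move=> lt_i ne_ip; have := pval_ltn s lt_i.
  by have := s_inj i p lt_i; lia.
(* Otherwise a, p, c would be a 231 pattern with the maximum as its 3. *)
have LR a c : a < p -> p < c -> c < (p + q).+1 -> pval s a < pval s c.
  move=> ap pc cn; have /s_lt sa : a < (p + q).+1 by lia.
  have := av a p c ap pc cn; rewrite smax; have := s_inj a c.
  by case: (ltngtP (pval s a) (pval s c)); lia.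
have R_ge c : p < c -> c < (p + q).+1 -> p <= pval s c.
  (* The p distinct values of L all lie below [pval s c]. *)
  move=> pc cn; apply: (@inj_bound _ _ (pval s)) => [i ip | i j ip jp].
    exact: LR.
  by apply: s_inj; lia.
have L_lt a : a < p -> pval s a < p.
  move=> ap; have sa_lt : pval s a < p + q by apply: s_lt; lia.
  (* The q distinct values of R lie strictly between [pval s a] and [p + q]. *)
  suff : q <= (p + q).-1 - pval s a by lia.
  have R_gt j : j < q -> pval s a < pval s (p.+1 + j) < p + q.
    by move=> jq; rewrite LR ?s_lt; lia.
  apply: (@inj_bound _ _ (fun j => pval s (p.+1 + j) - (pval s a).+1)).
    by move=> j /R_gt; lia.
  move=> i j iq jq; have := R_gt i iq; have := R_gt j jq.
  by have := s_inj (p.+1 + i) (p.+1 + j); lia.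
have R_lt j : j < q -> pval s (p.+1 + j) - p < q.
  by move=> jq; have := s_lt (p.+1 + j); have := R_ge (p.+1 + j); lia.
exists (nat_perm p (pval s)), (nat_perm q (fun j => pval s (p.+1 + j) - p)).
apply: eq_pval => i lt_i; rewrite glueE //; case: ltnP => [ip | pi].
  by rewrite nat_permE // => a b ap bp; apply: s_inj; lia.
case: eqP => [-> // | ne_ip]; rewrite nat_permE //; last by lia.
  have lt_pi : p < i by lia.
  by rewrite (subnKC lt_pi) subnKC ?R_ge.
move=> a b aq bq; have := R_ge (p.+1 + a); have := R_ge (p.+1 + b).
by have := s_inj (p.+1 + a) (p.+1 + b); lia.
Qed.

End PermutationsAsNatFunctions.

(** * The recurrence for the coefficients *)

Definition tail_coef (k q : nat) : {poly int} :=
  \sum_(v : 'S_q | avoids231 v && [forall j : 'I_q, j.+1 - v j <= k]%N) 'X^(des v).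

(** The condition [j.+1 - v j <= k] in [tail_coef] bounds the drops of R by k - 1 without taking a
    predecessor, so one formula also covers k = 0. *)
Lemma tail_coefS k q : tail_coef k.+1 q = A231_coef k q.
Proof.
apply: eq_bigl => v; congr (_ && _); apply/forallP/maxdrop_leP => dr j.
  by move=> jq; have := dr (Ordinal jq); rewrite -pvalE /=; lia.
by have := dr j (ltn_ord j); rewrite pvalE; lia.
Qed.

Lemma tail_coef0S q : tail_coef 0 q.+1 = 0.
Proof.
(* The position of the value 0 violates the bound. *)
apply: big_pred0 => v; apply/negP => /andP[_ /forallP/(_ (v^-1%g ord0))].
by rewrite permKV.
Qed.

Lemma des_S0 (s : 'S_0) : des s = 0%N.
Proof. by rewrite desE big_geq. Qed.

Lemma sum_des_S0 (P : pred 'S_0) :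
  (forall s, P s) -> \sum_(s : 'S_0 | P s) 'X^(des s) = 1 :> {poly int}.
Proof.
move=> Pall; rewrite (eq_bigr (fun=> 1)); last by move=> s _; rewrite des_S0.
rewrite (eq_bigl xpredT) // sumr_const.
by rewrite (_ : #|_| = 0`!%N) // -(card_Sn 0).
Qed.

Lemma A231_coef0 k : A231_coef k 0 = 1.
Proof.
apply: sum_des_S0 => s; apply/andP; split; first by apply/avoidsP => a b [].
by apply/maxdrop_leP.
Qed.

Lemma tail_coef_n0 k : tail_coef k 0 = 1.
Proof.
apply: sum_des_S0 => s; apply/andP; split; first by apply/avoidsP => a b [].
by apply/forallP; case.
Qed.

(** [glue] is a bijection from admissible pairs (L, R) onto the permutations on the left, and
    descents add up; the power of ['X] records the descent out of the maximum. *)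
Lemma sum_max_at k p q :
  \sum_(s : 'S_(p + q).+1 |
        avoids231 s && (maxdrop s <= k)%N && (pval s p == p + q)%N) 'X^(des s)
  = A231_coef k p * ('X ^+ (0 < q)%N * tail_coef k q).
Proof.
pose D := [set wv : 'S_p * 'S_q | (avoids231 wv.1 && (maxdrop wv.1 <= k)%N)
   && (avoids231 wv.2 && [forall j : 'I_q, j.+1 - wv.2 j <= k]%N)].
transitivity (\sum_(s in (fun wv => glue wv.1 wv.2) @: D) 'X^(des s) : {poly int}).
  apply: eq_bigl => s; apply/idP/imsetP => [/andP[/andP[av dr] /eqP smax] |].
    have [w [v eq_s]] := glue_surj av smax; exists (w, v) => //.
    move: av dr; rewrite eq_s glue_avoids glue_maxdrop inE /=.
    by move=> /andP[-> ->] /andP[-> ->].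
  case=> -[w v] /=; rewrite inE /= => /andP[/andP[avw drw] /andP[avv drv]] ->.
  by rewrite glue_avoids glue_maxdrop glueM avw drw avv drv eqxx.
rewrite big_imset /=; last first.
  by move=> [w v] [w' v'] _ _ /= /glue_inj[-> ->].
rewrite /A231_coef /tail_coef big_distrl /=.
under [RHS]eq_bigr do rewrite mulrA big_distrr /=.
rewrite pair_big_dep /=; apply: eq_big => [[w v] | [w v] _]; first by rewrite inE.
by rewrite glue_des !exprD.
Qed.

Lemma A231_coefS k n :
  A231_coef k n.+1 =
  \sum_(p < n.+1) A231_coef k p * ('X ^+ (0 < n - p)%N * tail_coef k (n - p)).
Proof.
(* Sort the permutations by the position of their maximum. *)
rewrite /A231_coef (partition_big (fun s : 'S_n.+1 => s^-1%g ord_max) xpredT) //=.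
apply: eq_bigr => p _; have eq_n : n = (p + (n - p))%N by rewrite subnKC // -ltnS.
transitivity (\sum_(s : 'S_n.+1 | avoids231 s && (maxdrop s <= k)%N
                && (pval s p == n)%N) 'X^(des s) : {poly int}).
  apply: eq_bigl => s; congr (_ && _); rewrite pvalE.
  by rewrite (canF_eq (permK s^-1)) invgK eq_sym.
(* Rewriting with [eq_n] also acts on the index of the type ['S_], which avoids a cast. *)
have := sum_max_at k p (n - p); by rewrite -eq_n.
Qed.

(** * From the recurrence to power series *)

Section PowerSeries.
Variable R : comUnitRingType.
Implicit Types f g : {fps R}.

Lemma fcoefD f g n : fcoef (f + g) n = fcoef f n + fcoef g n. Proof. by []. Qed.
Lemma fcoefN f n : fcoef (- f) n = - fcoef f n. Proof. by []. Qed.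
Lemma fcoef1 n : fcoef (1 : {fps R}) n = (n == 0%N)%:R. Proof. by case: n. Qed.

Lemma fcoefM f g n :
  fcoef (f * g) n = \sum_(i < n.+1) fcoef f i * fcoef g (n - i)%N.
Proof. by []. Qed.

Lemma fcoefCM c f n : fcoef (fpsC c * f) n = c * fcoef f n.
Proof.
rewrite fcoefM big_ord_recl /= subn0 big1 ?addr0 // => i _; exact: mul0r.
Qed.

Lemma fcoefTM0 f : fcoef (fpsT R * f) 0 = 0.
Proof. by rewrite fcoefM big_ord1 mul0r. Qed.

Lemma fcoefTMS f n : fcoef (fpsT R * f) n.+1 = fcoef f n.
Proof.
rewrite fcoefM big_ord_recl mul0r add0r big_ord_recl /= mul1r subSS subn0.
by rewrite big1 ?addr0 // => i _; apply: mul0r.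
Qed.

(** The equation says f (1 - t g) = 1, and 1 - t g is a unit because its constant term is 1. *)
Lemma fps_geometric f g : f = 1 + fpsT R * (f * g) -> f = 1 / (1 - fpsT R * g).
Proof.
move=> fE; have := unitfps1DTM (- g); rewrite mulrN => u_g.
apply: (mulIr u_g); rewrite divrK // mulrBr mulr1 {1}fE.
by rewrite mulrCA addrK.
Qed.

End PowerSeries.

Lemma A231_eq k (C : {fps {poly int}}) :
    (forall q, fcoef C q = 'X ^+ (0 < q)%N * tail_coef k q) ->
  A231 k = 1 / (1 - fpsT _ * C).
Proof.
move=> CE; apply: fps_geometric; apply: fpsP => -[|n].
  by rewrite fcoefD fcoefTM0 fcoef1 addr0.
rewrite fcoefD fcoefTMS fcoef1 add0r fcoefM /= A231_coefS.
apply: eq_bigr => p _; rewrite CE; congr (_ * _).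
(* [A231] sets its constant term to 1 by a case distinction; this agrees with the sum over
   ['S_0]. *)
by case: ifP => // /eqP->; apply: A231_coef0.
Qed.

Theorem theorem1 :
  let x : {fps {poly int}} := fpsC 'X in
  let t : {fps {poly int}} := fpsT _ in
  A231 0 = 1 / (1 - t) /\
  forall k : nat, (1 <= k)%N ->
    A231 k = 1 / (1 - t + t * x - t * x * A231 (k - 1)%N).
Proof.
move=> x t; split.
  (* For k = 0 only the empty R is allowed, so C = 1. *)
  rewrite -[X in 1 - X]mulr1; apply: A231_eq => -[|q].
    by rewrite tail_coef_n0 mulr1.
  by rewrite tail_coef0S mulr0.
case=> // k _; rewrite subn1 /=.
have -> : 1 - t + t * x - t * x * A231 k = 1 - t * (1 - x + x * A231 k).
  by ring.
apply: A231_eq => q; rewrite fcoefD fcoefCM fcoefD fcoefN fcoef1 tail_coefS.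
(* The constant term of C is 1 - x + x = 1, with no factor x for an empty R; in higher degrees only
   x A_(k-1) contributes. *)
case: q => [|q] /=; first by rewrite A231_coef0 mulr1 subrK mulr1.
by rewrite subr0 add0r expr1.
Qed.
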